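(* Let $\mathcal{H}=\{rrr,rrb,bby\}$. Then, as $n\to\infty$, $h_2(n,\mathcal{H})=\Omega(\sqrt{n\log n})$ and $h_2(n,\mathcal{H})=O(n^{2/3}\sqrt{\log n})$.
   Context: Edge-colorings of the complete graph $K_n$ use colors from $\{r,b,y\}$ (red, blue, yellow); they need not be proper, and not all colors need be used. A pattern is an edge-colored triangle, denoted by the multiset of the colors of its three edges; e.g. $rrr$ is the all-red triangle, $rrb$ is the triangle with two red edges and one blue edge, and $bby$ has two blue edges and one yellow edge. For a family $\mathcal{H}$ of patterns, $\operatorname{Forb}(n,\mathcal{H})$ is the set of all edge-colorings of $K_n$ with colors from $\{r,b,y\}$ in which no triangle has a coloring belonging to $\mathcal{H}$. For an edge-coloring $c$ of $K_n$, $h_2(c)$ is the maximum $k$ such that there is a set of $k$ vertices whose induced edges use at most two of the three colors. Finally, $h_2(n,\mathcal{H})=\min\{h_2(c): c\in\operatorname{Forb}(n,\mathcal{H})\}$. Here $\log$ is the base-2 logarithm. *)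

(* Defs.v *)
From HB Require Import structures.
From mathcomp Require Import all_boot all_order all_algebra.
From mathcomp Require Import all_classical all_reals all_analysis.

Set Implicit Arguments.
Unset Strict Implicit.
Unset Printing Implicit Defensive.

Import Order.TTheory GRing.Theory Num.Theory.
Import numFieldNormedType.Exports.

Inductive color : predArgType := red | blue | yellow.

Definition code_color (x : color) : option bool :=
  match x with red => None | blue => Some true | yellow => Some false end.

Definition decode_color (i : option bool) : color :=
  match i with None => red | Some true => blue | Some false => yellow end.

Lemma code_colorK : cancel code_color decode_color.
Proof. by case. Qed.

HB.instance Definition _ := Finite.copy color (can_type code_colorK).

Definition edge (n : nat) : finType := {e : {set 'I_n} | #|e| == 2}.

Definition coloring (n : nat) : finType := {ffun edge n -> color}.

Definition edges_in n (S : {set 'I_n}) : {set edge n} :=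
  [set e : edge n | val e \subset S].

(* A multiset of three colors; tuples are always compared up to [perm_eq]. *)
Definition pattern := 3.-tuple color.

Definition has_pattern n (c : coloring n) (T : {set 'I_n}) (p : pattern) : bool :=
  (#|T| == 3) && perm_eq [seq c e | e in edges_in T] p.

Definition Forb n (H : seq pattern) : {set coloring n} :=
  [set c : coloring n | [forall T : {set 'I_n}, ~~ has (has_pattern c T) H]].

Definition colors_in n (c : coloring n) (S : {set 'I_n}) : {set color} :=
  [set c e | e in edges_in S].

Definition h2c n (c : coloring n) : nat :=
  \max_(S : {set 'I_n} | #|colors_in c S| <= 2) #|S|.

(* Since [h2c c <= n] for every [c], the default value [n] does not affect the
   minimum unless [Forb n H] is empty. *)
Definition h2 (n : nat) (H : seq pattern) : nat :=
  \big[minn/n]_(c in Forb n H) h2c c.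

Definition rrr : pattern := [tuple red; red; red].
Definition rrb : pattern := [tuple red; red; blue].
Definition bby : pattern := [tuple blue; blue; yellow].

Local Open Scope ring_scope.

Definition log2 (R : realType) (x : R) : R := ln x / ln 2.

(* Main.v *)
Require Import Defs.
From mathcomp Require Import all_boot all_order all_algebra all_field.
From mathcomp Require Import ring lra zify.

(* Lower bound: the red graph is triangle-free and its independent sets miss a
   color, so the bound is that of Ajtai, Komlos and Szemeredi on triangle-free
   graphs. With [a] the independence number, all degrees are at most [a], and
   if all degrees are at most [D >= 16 ^ L] then averaging
   [D * (v \in W) + #|W :&: N(v)|] over all vertices [v] and all independent
   sets [W] gives [n * L <= 2 * D * a].

   Upper bound, even [O(n ^ (2 / 3))]: color the points [(a, b, c)] of [F ^ 3],
   with [q = #|F|]. The lines [b = m a - e, c = m a ^ 2 - f] form a partial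
   linear space without triangles, with [q] lines through every point. Points
   with the same [(a, b)] are blue; two points on a line are red when a bit
   attached to each flag differs at them; other pairs are yellow. Two red edges
   at a point never lead to two points with the same [(a, b)]. If a set [A] has
   no red edge then the bits are constant on every trace of [A] on a line, which
   holds for a proportion at most [2 ^ (q ^ 3 - q * #|A|)] of the choices; the
   union bound over the [2 ^ (q ^ 3)] sets gives bits for which all red-free
   sets have size at most [2 * q ^ 2]. *)

Set Implicit Arguments.
Unset Strict Implicit.
Unset Printing Implicit Defensive.
Import GRing.Theory.
Local Open Scope nat_scope.

(** * Independent sets in triangle-free graphs *)

(** Pairing each subset [Y] with [X :\: Y] shows that the mean size is half of [#|X|]. *)
Lemma sum_card_powerset (T : finType) (X : {set T}) :
  2 * \sum_(Y in powerset X) #|Y| = #|X| * 2 ^ #|X|.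
Proof.
have compl : \sum_(Y in powerset X) #|Y| = \sum_(Y in powerset X) #|X :\: Y|.
  rewrite (reindex_onto (setD X) (setD X)) /=; last first.
    by move=> Y; rewrite inE => YX; rewrite setDDr setDv set0U; apply/setIidPr.
  apply: eq_bigl => Y; rewrite !inE subsetDl /=.
  rewrite setDDr setDv set0U; apply/eqP/idP => [<-|/setIidPr //].
  exact: subsetIl.
rewrite mul2n -addnn {2}compl -big_split /= (eq_bigr (fun=> #|X|)); last first.
  move=> Y; rewrite inE => /setIidPr YX.
  by rewrite -[in RHS](cardsID Y X) YX.
by rewrite sum_nat_const card_powerset mulnC.
Qed.

(** In the application [x] neighbours of [v] are free, [(2 ^ x).+1] independent sets share a trace,
    and [s] is the total size of the free subsets. If [x >= 2 L + 2] then [s] alone suffices;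
    otherwise [2 ^ x <= 2 * 4 ^ L], and [D >= 4 ^ L * 4 ^ L] suffices because [3 L <= 4 ^ L]. *)
Lemma leq_trade_off (L D x s : nat) :
  16 ^ L <= D -> 2 * s = x * 2 ^ x -> L * (2 ^ x).+1 <= D + s.
Proof.
move=> LD ss; have [->|L0] := posnP L; first by rewrite mul0n.
have [xL|xL] := leqP (2 * L).+2 x.
  suff : 2 * (L * (2 ^ x).+1) <= 2 * s by lia.
  have := ltn_expl x (ltnSn 1); rewrite ss => ?; nia.
have L4 : 3 * L <= 4 ^ L.
  elim: L L0 {LD xL} => // -[|L] // /(_ isT) IH _; rewrite expnS; lia.
have : 2 ^ x <= 2 * 4 ^ L.
  by rewrite -(expnM 2 2) -expnS leq_exp2l //; lia.
have -> : D = D - 16 ^ L + 16 ^ L by lia.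
rewrite (expnMn 4 4); set p := 2 ^ x; set r := 4 ^ L; nia.
Qed.

Section TriangleFree.

Variables (T : finType) (e : rel T).

Definition indep (A : {set T}) := [forall x in A, forall y in A, ~~ e x y].

Lemma indepP (A : {set T}) :
  reflect {in A &, forall x y, ~~ e x y} (indep A).
Proof.
apply: (iffP forall_inP) => [h x y xA yA|h x xA].
  exact: (forall_inP (h x xA)).
by apply/forall_inP => y yA; apply: h.
Qed.

Lemma indepS (A B : {set T}) : A \subset B -> indep B -> indep A.
Proof.
move=> /subsetP AB /indepP iB; apply/indepP => x y xA yA.
by apply: iB; apply: AB.
Qed.

Hypothesis e_sym : symmetric e.
Hypothesis e_tf : forall x y z, e x y -> e y z -> ~~ e x z.

Let e_irr x : ~~ e x x.
Proof. by apply/negP => exx; move: (e_tf exx exx); rewrite exx. Qed.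

Lemma indep_nbhd v : indep [set u | e v u].
Proof.
by apply/indepP => x y; rewrite !inE e_sym => xv vy; apply: e_tf xv vy.
Qed.

(* Conditioned on its trace [H] outside the closed neighbourhood of [v], a
   uniformly random independent set is either [v |: H] or the union of [H] and
   an arbitrary subset of the neighbours of [v] that have no neighbour in [H]. *)
Lemma sum_indep_local (L D : nat) (v : T) : 16 ^ L <= D ->
  L * #|[set W | indep W]| <=
  \sum_(W in [set W | indep W]) (D * (v \in W) + #|W :&: [set u | e v u]|).
Proof.
move=> LD; set N := [set u | e v u]; set I := [set W | indep W].
have vN : v \notin N by rewrite inE.
pose f (W : {set T}) := W :\: (v |: N).
rewrite -sum1_card (partition_big f predT) //= [leqRHS](partition_big f predT) //=.
rewrite big_distrr; apply: leq_sum => H _ /=.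
have [[W0 W0I fW0]|no] := altP (@exists_inP _ (mem I) (fun W => f W == H));
  last first.
  rewrite big_pred0 ?muln0 // => W; apply/negP => /andP[WI fW].
  by move: no; rewrite negb_exists_in => /forall_inP/(_ W WI); rewrite fW.
have iH : indep H.
  have : W0 \in I by [].
  by rewrite inE -(eqP fW0); apply/indepS/subsetDl.
have HN u : u \in H -> u \notin v |: N by rewrite -(eqP fW0) !inE => /andP[].
have vH : v \notin H by apply/negP => /HN; rewrite !inE eqxx.
pose X := [set u in N | [forall w in H, ~~ e u w]].
have XN : X \subset N by apply/subsetP => u; rewrite inE => /andP[].
have fiber : [set W in I | f W == H] =
    (v |: H) |: [set H :|: Y | Y in powerset X].
  apply/setP => W; rewrite [LHS]inE [W \in I]inE in_setU1; apply/andP/orP.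
  - case=> /indepP iW /eqP fW; have [vW|vW] := boolP (v \in W).
      left; apply/eqP/setP => u; rewrite -fW /f !inE.
      have [->|_] := eqVneq u v; first by rewrite vW.
      by rewrite /= andb_idl // => uW; apply: iW.
    right; apply/imsetP; exists (W :&: N).
      rewrite inE; apply/subsetP => u; rewrite !inE => /andP[uW ->] /=.
      by apply/forall_inP => w; rewrite -fW /f inE => /andP[_ wW]; apply: iW.
    apply/setP => u; rewrite -fW /f !inE.
    have [->|_] := eqVneq u v; first by rewrite (negbTE vW).
    by case: (u \in W); rewrite ?andbF ?andbT //=; case: (e v u).
  - case=> [/eqP->|/imsetP[Y]].
      split; last first.
        apply/eqP/setP => u; rewrite /f !inE.
        have [->|uv] := eqVneq u v; first by rewrite (negbTE vH).
        by rewrite /= andb_idl // => /HN; rewrite !inE negb_or => /andP[].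
      have vHe u : u \in H -> ~~ e v u.
        by move=> /HN; rewrite !inE negb_or => /andP[].
      apply/indepP => x y; rewrite !inE => /predU1P[->|xH] /predU1P[->|yH] //.
      + exact: vHe.
      + by rewrite e_sym; apply: vHe.
      + by apply: (indepP _ iH).
    rewrite inE => YX ->; split; last first.
      apply/eqP/setP => u; rewrite /f !inE.
      have := HN u; rewrite !inE; case: (u \in H) => /= [-> //|_].
      case: (boolP (u \in Y)) => [uY|]; rewrite ?andbF //.
      by have := subsetP XN u (subsetP YX u uY); rewrite inE => ->; rewrite orbT.
    have YH u w : u \in Y -> w \in H -> ~~ e u w.
      by move=> /(subsetP YX); rewrite inE => /andP[_ /forall_inP]; apply.
    apply/indepP => x y; rewrite !inE => /orP[xH|xY] /orP[yH|yY].
    + by apply: (indepP _ iH).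
    + by rewrite e_sym; apply: YH.
    + exact: YH.
    + by apply: (indepP _ (indep_nbhd v)); apply: (subsetP XN); apply: (subsetP YX).
have HY0 (Y : {set T}) : Y \subset X -> (H :|: Y) :&: N = Y.
  move=> YX; apply/setP => u; rewrite in_setI in_setU.
  have := HN u; rewrite in_setU1 negb_or; case: (u \in H) => /= [/(_ isT)/andP[_]|_].
    move=> uN; rewrite (negbTE uN); apply/esym/negbTE.
    by apply: contra uN => /(subsetP YX)/(subsetP XN).
  by rewrite andb_idr // => /(subsetP YX)/(subsetP XN).
have inj : {in powerset X &, injective (fun Y => H :|: Y)}.
  by move=> Y Z; rewrite !inE => YX ZX YZ; rewrite -(HY0 Y) // YZ HY0.
have vY (Y : {set T}) : Y \subset X -> v \notin H :|: Y.
  rewrite inE negb_or vH => YX; apply: contra vN.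
  by move=> /(subsetP YX)/(subsetP XN).
have vnot : v |: H \notin [set H :|: Y | Y in powerset X].
  apply/imsetP => -[Y]; rewrite inE => /vY vY' /setP/(_ v).
  by rewrite setU11 (negbTE vY').
have bigF (F : {set T} -> nat) : \sum_(W in I | f W == H) F W =
    F (v |: H) + \sum_(Y in powerset X) F (H :|: Y).
  rewrite -(big_imset F inj) -big_setU1 // -fiber.
  by apply: eq_bigl => W; rewrite inE.
(* The set [v |: H] contributes at least [D] and each [H :|: Y] at least [#|Y|], against [L] for
   every member of the fiber. *)
rewrite !bigF sum1_card card_powerset add1n setU11 muln1 -addnA.
apply: leq_trans (leq_trade_off (s := \sum_(Y in powerset X) #|Y|) LD _) _.
  exact: sum_card_powerset.
rewrite leq_add2l (leq_trans _ (leq_addl _ _)) //.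
by apply: leq_sum => Y; rewrite inE => YX; rewrite HY0 // leq_addl.
Qed.

Lemma indep_degree_bound (L D a : nat) : 16 ^ L <= D ->
    (forall v, #|[set u | e v u]| <= D) -> (forall W, indep W -> #|W| <= a) ->
  #|T| * L <= 2 * D * a.
Proof.
move=> LD deg ha; set I := [set W | indep W].
have I0 : 0 < #|I|.
  by apply/card_gt0P; exists set0; rewrite inE; apply/indepP => x; rewrite inE.
rewrite -(leq_pmul2r I0) -mulnA.
have -> : #|T| * (L * #|I|) = \sum_(v : T) L * #|I|.
  by rewrite sum_nat_const.
apply: leq_trans (leq_sum _ (fun v _ => sum_indep_local v LD)) _.
rewrite exchange_big /= [leqRHS]mulnC -sum_nat_const; apply: leq_sum => W.
rewrite inE => /ha Wa; rewrite big_split /= -big_distrr /=.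
have -> : \sum_(v : T) (v \in W : nat) = #|W|.
  by rewrite -sum1_card [RHS]big_mkcond; apply: eq_bigr => v _; case: ifP.
(* The sum counts adjacent pairs with one end in [W]; each [u] in [W] occurs at most [D] times. *)
suff : \sum_(v : T) #|W :&: [set u | e v u]| <= #|W| * D by nia.
have -> : \sum_(v : T) #|W :&: [set u | e v u]| =
          \sum_(v : T) \sum_(u in W) (e u v : nat).
  apply: eq_bigr => v _; rewrite -sum1_card [LHS]big_mkcond [RHS]big_mkcond /=.
  by apply: eq_bigr => u _; rewrite !inE e_sym; case: (u \in W); case: (e u v).
rewrite exchange_big /= -sum_nat_const; apply: leq_sum => u uW.
apply: leq_trans (deg u); rewrite -sum1_card [leqRHS]big_mkcond.
by apply: leq_sum => v _; rewrite inE; case: (e u v).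
Qed.

(** Neighbourhoods are independent, so degrees are at most [a]. If [16 ^ L <= a], take [D = a].
    Otherwise [D = 16 ^ L] would give [D ^ 2 * L <= 2 * D * a < 2 * D ^ 2], impossible for
    [L > 1]. *)
Lemma indep_lower_bound (L a : nat) : 1 < L -> 256 ^ L <= #|T| ->
  (forall W, indep W -> #|W| <= a) -> #|T| * L <= 2 * a ^ 2.
Proof.
move=> L1 LT ha; have deg v : #|[set u | e v u]| <= a by apply: ha (indep_nbhd v).
have [aL|aL] := leqP (16 ^ L) a.
  by have := indep_degree_bound aL deg ha; rewrite -mulnA mulnn.
have deg' v : #|[set u | e v u]| <= 16 ^ L by apply: leq_trans (ltnW aL).
have := indep_degree_bound (leqnn _) deg' ha.
move: LT; rewrite (expnMn 16 16); set D := 16 ^ L in aL *; nia.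
Qed.

End TriangleFree.

(** * Colorings as functions of pairs of vertices *)

Lemma exists_notin (T : finType) (A : {set T}) :
  reflect (exists k, k \notin A) (#|A| < #|T|).
Proof.
apply: (iffP idP) => [AT|[k kA]].
  have [k] : exists k, k \in ~: A by apply/card_gt0P; have := cardsC A; lia.
  by rewrite inE => kA; exists k.
have /card_gt0P : exists k, k \in ~: A by exists k; rewrite inE.
by have := cardsC A; lia.
Qed.

Section PairColor.

Variables (n : nat) (c : coloring n).
Implicit Types (x y z : 'I_n) (S : {set 'I_n}) (k : color).

(** The default [red] is reached only when [x = y], where [[set x; y]] is not an edge. *)
Definition pair_color x y : color := oapp c red (insub [set x; y]).

Lemma pair_colorC x y : pair_color x y = pair_color y x.
Proof. by rewrite /pair_color setUC. Qed.

Lemma pair_colorE (e : edge n) x y : val e = [set x; y] -> pair_color x y = c e.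
Proof. by rewrite /pair_color => <-; rewrite valK. Qed.

Lemma edge_of x y : x != y -> exists e : edge n, val e = [set x; y].
Proof.
move=> xy; have h : #|[set x; y]| == 2 by rewrite cards2 xy.
by exists (Sub [set x; y] h); rewrite SubK.
Qed.

Lemma edge_ends (e : edge n) : exists x y, x != y /\ val e = [set x; y].
Proof. by apply/cards2P; apply: (valP e). Qed.

Lemma triangle_colors x y z : x != y -> y != z -> x != z ->
  perm_eq [seq c e | e in edges_in [set x; y; z]]
          [:: pair_color x y; pair_color y z; pair_color x z].
Proof.
move=> xy yz xz.
have [e1 e1E] := edge_of xy; have [e2 e2E] := edge_of yz.
have [e3 e3E] := edge_of xz.
rewrite (pair_colorE e1E) (pair_colorE e2E) (pair_colorE e3E).
rewrite -[[:: c e1; _; _]]/(map c [:: e1; e2; e3]) perm_map //.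
apply: uniq_perm; first exact: enum_uniq.
  have e12 : e1 != e2.
    apply/eqP => /(congr1 val); rewrite e1E e2E => /setP/(_ x).
    by rewrite !inE eqxx (negbTE xy) (negbTE xz).
  have e13 : e1 != e3.
    apply/eqP => /(congr1 val); rewrite e1E e3E => /setP/(_ y).
    by rewrite !inE eqxx eq_sym (negbTE xy) (negbTE yz).
  have e23 : e2 != e3.
    apply/eqP => /(congr1 val); rewrite e2E e3E => /setP/(_ y).
    by rewrite !inE eqxx [y == x]eq_sym (negbTE xy) (negbTE yz).
  by rewrite /= !inE (negbTE e12) (negbTE e13) (negbTE e23).
move=> e; rewrite mem_enum !inE; apply/idP/idP; last first.
  case/or3P => /eqP ->; rewrite ?e1E ?e2E ?e3E; apply/subsetP => u;
  by rewrite !inE => /orP[] /eqP->; rewrite eqxx ?orbT.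
have [a [b [ab eab]]] := edge_ends e.
have eqe e' : val e' = [set a; b] -> e == e'.
  by move=> e'E; apply/eqP/val_inj; rewrite eab e'E.
have eqe' e' : val e' = [set b; a] -> e == e' by rewrite setUC; apply: eqe.
rewrite eab => /subsetP sub; have := sub a; have := sub b.
rewrite !inE !eqxx orbT => /(_ isT) hb /(_ isT) ha.
case/orP: ha => [/orP[]|] /eqP aE; case/orP: hb => [/orP[]|] /eqP bE;
  move: ab eqe eqe'; rewrite aE bE ?eqxx // => _ eqe eqe'.
all: by apply/or3P; solve [ apply: Or31; auto | apply: Or32; auto | apply: Or33; auto].
Qed.

Lemma ForbP (H : seq pattern) :
  reflect (forall x y z, x != y -> y != z -> x != z -> forall p, p \in H ->
             ~~ perm_eq [:: pair_color x y; pair_color y z; pair_color x z] p)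
          (c \in Forb n H).
Proof.
rewrite inE; apply: (iffP forallP) => [h x y z xy yz xz p pH|h T].
  have := h [set x; y; z]; apply: contra => hp; apply/hasP; exists p => //.
  rewrite /has_pattern (perm_trans (triangle_colors xy yz xz) hp) andbT.
  rewrite setUC cardsU1 !inE cards2 xy negb_or.
  by rewrite ![z == _]eq_sym xz yz.
apply/hasPn => p pH; apply/negP => /andP[T3 Tp].
have [x xT] : exists x, x \in T by apply/card_gt0P; rewrite (eqP T3).
have : #|T :\ x| == 2 by rewrite (cardsD1 x) xT in T3.
case/cards2P => y [z [yz Txyz]].
have /setP/(_ y) := Txyz; have /setP/(_ z) := Txyz; rewrite !inE !eqxx orbT /=.
move=> /andP[zx _] /andP[yx _].
have TE : T = [set x; y; z] by rewrite -setUA -Txyz setD1K.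
have xy : x != y by rewrite eq_sym.
have xz : x != z by rewrite eq_sym.
have /negP[] := h x y z xy yz xz p pH; apply: perm_trans Tp.
by rewrite perm_sym TE triangle_colors.
Qed.

Lemma colors_inP S k :
  reflect (exists x y, [/\ x \in S, y \in S, x != y & pair_color x y = k])
          (k \in colors_in c S).
Proof.
apply: (iffP imsetP) => [[e]|[x [y [xS yS xy <-]]]].
  rewrite inE; have [x [y [xy exy]]] := edge_ends e.
  move=> /subsetP; rewrite exy => eS ->; exists x, y.
  by rewrite (pair_colorE exy) xy; split=> //; apply: eS; rewrite !inE eqxx ?orbT.
have [e exy] := edge_of xy; exists e; last exact: pair_colorE.
rewrite inE exy; apply/subsetP => u; rewrite !inE.
by case/orP => /eqP->.
Qed.

Lemma card_color : #|{: color}| = 3.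
Proof.
have codeK : cancel decode_color code_color by case=> [[]|].
by rewrite (bij_eq_card (Bijective code_colorK codeK)) card_option card_bool.
Qed.

(** There are three colors in all; thus [h2c] is the largest size of a set that misses some
    color. *)
Lemma missing_color (A : {set color}) :
  reflect (exists k, k \notin A) (#|A| <= 2).
Proof. by rewrite -ltnS -card_color; apply: exists_notin. Qed.

Lemma h2c_ge S k : {in S &, forall x y, x != y -> pair_color x y != k} ->
  #|S| <= h2c c.
Proof.
move=> Sk; apply: (leq_bigmax_cond (F := fun S : {set 'I_n} => #|S|)).
apply/missing_color; exists k; apply/colors_inP => -[x [y [xS yS xy]]].
by apply/eqP; apply: Sk.
Qed.

Lemma h2c_le b :
  (forall S k, {in S &, forall x y, x != y -> pair_color x y != k} ->
    #|S| <= b) -> h2c c <= b.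
Proof.
move=> h; apply/bigmax_leqP => S /missing_color[k kS]; apply: (h S k).
move=> x y xS yS xy; apply: contra kS => /eqP xyk.
by apply/colors_inP; exists x, y.
Qed.

End PairColor.

(** * From single colorings to [h2], and the lower bound *)

Lemma h2_le n (H : seq pattern) (c : coloring n) :
  c \in Forb n H -> h2 n H <= h2c c.
Proof.
rewrite /h2 => cH; elim: index_enum (mem_index_enum c) => //= d s IH.
rewrite big_cons inE => /predU1P[<-|/IH {}IH]; first by rewrite cH geq_minl.
by case: ifP => // _; apply: leq_trans (geq_minr _ _) IH.
Qed.

Lemma h2_ge n (H : seq pattern) b :
  b <= n -> {in Forb n H, forall c, b <= h2c c} -> b <= h2 n H.
Proof.
move=> bn bc; rewrite /h2; elim/big_ind: _ => // x y bx by_.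
by rewrite leq_min bx.
Qed.

Local Notation three_patterns := [:: rrr; rrb; bby].

Lemma h2_lower_bound n L : 1 < L -> 256 ^ L <= n -> n * L <= 2 * (h2 n three_patterns) ^ 2.
Proof.
move=> L1 Ln; have Ln' : L <= n by apply: leq_trans Ln; rewrite ltnW // ltn_expl.
rewrite /h2; elim/big_ind: _ => [|x y nx ny|c cH].
(* The default value [n] of the minimum satisfies the bound because [L <= n]. *)
- by rewrite -mulnn; nia.
- by rewrite /minn; case: ifP.
pose e := [rel x y : 'I_n | (x != y) && (pair_color c x y == red)].
rewrite -[X in X * L]card_ord; apply: (indep_lower_bound (e := e)) L1 _ _.
- by move=> x y /=; rewrite eq_sym pair_colorC.
- move=> x y z /= /andP[xy /eqP xyr] /andP[yz /eqP yzr].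
  apply/andP => -[xz /eqP xzr].
  have /negP[] := ForbP _ _ cH x y z xy yz xz rrr (mem_head _ _).
  by rewrite xyr yzr xzr.
- by rewrite card_ord.
- move=> W /indepP iW; apply: (h2c_ge (k := red)) => x y xW yW xy.
  by have := iW x y xW yW; rewrite /= xy.
Qed.

(** * The point-line construction *)

Section Construction.

Variable F : finFieldType.
Local Notation q := #|F|.
Local Notation point := (F * F * F)%type.
Implicit Types (x y z : point) (m : F) (s : {set point * F}).

(* The lines [b = m a - e, c = m a ^ 2 - f] of the points [(a, b, c)] are named
   by [(m, e, f)], and a flag by its line and the abscissa of its point. *)
Definition line x m : point :=
  (m, m * x.1.1 - x.1.2, m * x.1.1 ^+ 2 - x.2)%R.

Definition flag x m : point * F := (line x m, x.1.1).

(** The set [s] holds the flags with bit 1. Differing bits already force [x] and [y] to be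
    distinct. *)
Definition red_pair s x y :=
  [exists m, (line x m == line y m) && ((flag x m \in s) != (flag y m \in s))].

Lemma line_slope x y m m' : line x m = line y m' -> m = m'.
Proof. by case. Qed.

Lemma line_abscissa x y m : line x m = line y m -> x.1.1 = y.1.1 -> x = y.
Proof.
case: x y => [[a b] c] [[a' b'] c'] /= [bE cE] /= aa'; rewrite -aa' in bE cE *.
by congr (_, _, _); [move/addrI/oppr_inj: bE | move/addrI/oppr_inj: cE].
Qed.

Lemma flag_inj : injective (fun t : point * F => flag t.1 t.2).
Proof.
move=> [x m] [y m'] [/= mm']; rewrite -mm' => bE cE aE.
by congr (_, _); apply: (line_abscissa (m := m)) => //; congr (_, _, _).
Qed.

Lemma red_pairP s x y : reflect
  (exists m, [/\ line x m = line y m, x.1.1 <> y.1.1 &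
                 (flag x m \in s) != (flag y m \in s)])
  (red_pair s x y).
Proof.
apply: (iffP existsP) => [[m /andP[/eqP lE bits]]|[m [lE _ bits]]]; exists m.
  split=> // /(line_abscissa lE) xy; by rewrite xy eqxx in bits.
by rewrite lE eqxx.
Qed.

Lemma red_pairC s x y : red_pair s x y = red_pair s y x.
Proof. by apply: eq_existsb => m; rewrite eq_sym [X in _ && ~~ X]eq_sym. Qed.

(** Both alternatives yield [(m1 - m2) (a - a') (a' - a'') = 0]. The first serves to exclude two red
    edges closed by a blue one, the second to exclude triangles of lines. *)
Lemma two_steps_parallel x y z m1 m2 : x.1.1 <> y.1.1 -> y.1.1 <> z.1.1 ->
  line x m1 = line y m1 -> line y m2 = line z m2 ->
  x.1 = z.1 \/ (exists m3, line x m3 = line z m3) -> m1 = m2.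
Proof.
case: x y z => [[a b] c] [[a' b'] c'] [[a'' b''] c''] /= aa' a'a''.
move=> [/eqP e1 /eqP f1] [/eqP e2 /eqP f2] h; rewrite -subr_eq0 in e1.
rewrite -subr_eq0 in f1; rewrite -subr_eq0 in e2; rewrite -subr_eq0 in f2.
suff /eqP : ((m1 - m2) * ((a - a') * (a' - a'')) = 0)%R.
  rewrite !mulf_eq0 !subr_eq0 => /or3P[/eqP //|/eqP //|/eqP //].
case: h => [[ea eb]|[m3 [/eqP e3 /eqP f3]]].
  rewrite -ea -eb in e2 f2 *.
  transitivity (((m1 * a - b - (m1 * a' - b')) + (m2 * a' - b' - (m2 * a - b)))
     * (a' - a))%R; first by ring.
  by rewrite (eqP e1) (eqP e2) addr0 mul0r.
rewrite -subr_eq0 in e3; rewrite -subr_eq0 in f3.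
(* Subtracting [a + a''] times the relation between the [b] coordinates from the one between the [c]
   coordinates eliminates [m3]. *)
transitivity ((m1 * a ^+ 2 - c - (m1 * a' ^+ 2 - c'))
   + (m2 * a' ^+ 2 - c' - (m2 * a'' ^+ 2 - c''))
   - (m3 * a ^+ 2 - c - (m3 * a'' ^+ 2 - c''))
   - (a + a'') * ((m1 * a - b - (m1 * a' - b'))
     + (m2 * a' - b' - (m2 * a'' - b'')) - (m3 * a - b - (m3 * a'' - b''))))%R.
  by ring.
by rewrite (eqP e1) (eqP e2) (eqP e3) (eqP f1) (eqP f2) (eqP f3)
           !(subr0, addr0, mulr0).
Qed.

Lemma red_pair_base s x y : red_pair s x y -> x.1 <> y.1.
Proof. by case/red_pairP => m [_ aa' _] xy; rewrite xy in aa'. Qed.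

(** The two lines through [y] have the same slope, so they coincide, and a line has one point of
    each abscissa. *)
Lemma red_pair_base_inj s x y z :
  red_pair s x y -> red_pair s y z -> x.1 = z.1 -> x = z.
Proof.
move=> /red_pairP[m1 [l1 a1 _]] /red_pairP[m2 [l2 a2 _]] xz.
have m12 := two_steps_parallel a1 a2 l1 l2 (or_introl xz); subst m2.
by apply: (line_abscissa (m := m1)); rewrite ?l1 // xz.
Qed.

(** All three points lie on one line, and three bits cannot be pairwise different. *)
Lemma red_pair_triangle s x y z :
  red_pair s x y -> red_pair s y z -> red_pair s x z -> False.
Proof.
move=> /red_pairP[m1 [l1 a1 b1]] /red_pairP[m2 [l2 a2 b2]].
move=> /red_pairP[m3 [l3 a3 b3]].
have m12 : m1 = m2.
  by apply: two_steps_parallel a1 a2 l1 l2 _; right; exists m3.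
have m13 : m1 = m3.
  apply: (@two_steps_parallel y x z); [exact: nesym | exact: a3 | by [] | by [] |].
  by right; exists m2.
subst m2 m3; move: b1 b2 b3.
by case: (flag x m1 \in s); case: (flag y m1 \in s); case: (flag z m1 \in s).
Qed.

(** * Counting the bit choices that leave a set red-free *)

Definition red_free s (A : {set point}) := indep (red_pair s) A.

(* If [A] is red-free then [s] is constant along every line on the flags of
   [A], so it is determined by these values and by its other flags. *)
Lemma card_red_free (A : {set point}) :
  #|[set s | red_free s A]| <= 2 ^ (q ^ 3 + (q ^ 4 - q * #|A|)) /\
  q * #|A| <= q ^ 4.
Proof.
pose I := [set flag t.1 t.2 | t in setX A [set: F]].
have cardI : #|I| = q * #|A|.
  by rewrite card_imset; [rewrite cardsX cardsT mulnC | exact: flag_inj].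
have cardPF : #|{: point * F}| = q ^ 4 by rewrite !card_prod !expnSr expn0 mul1n.
have cardP : #|{: point}| = q ^ 3 by rewrite !card_prod !expnSr expn0 mul1n.
split; last by rewrite -cardI -cardPF max_card.
(* Decoding map: [t.1] is the set of lines where the flags of [A] have bit 1, and [t.2] holds the
   other flags with bit 1. Lines are named by points, so there are [q ^ 3] of them. *)
pose g (t : {set point} * {set point * F}) :=
  t.2 :|: [set z in I | z.1 \in t.1].
have sub : [set s | red_free s A] \subset
    [set g t | t in setX [set: {set point}] (powerset (~: I))].
  apply/subsetP => s; rewrite inE => /indepP sA.
  apply/imsetP; exists ([set z.1 | z in s :&: I], s :\: I).
    rewrite !inE /=; apply/subsetP => z; rewrite !inE.
    by case/andP.
  apply/setP => z; rewrite !inE /=; case: (boolP (z \in I)) => zI /=; last first.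
    by rewrite orbF.
  apply/idP/imsetP => [zs|[z']]; first by exists z; rewrite // inE zs.
  rewrite inE => /andP[z's z'I].
  move: zI z'I z's => /imsetP[[x m] + ->] /imsetP[[y m'] + ->] /=.
  rewrite !inE !andbT => xA yA ys lE; have mm' := line_slope lE; subst m'.
  have := sA x y xA yA; rewrite negb_exists => /forallP/(_ m).
  by rewrite lE eqxx /= negbK ys => /eqP.
apply: leq_trans (subset_leq_card sub) _; apply: leq_trans (leq_imset_card _ _) _.
rewrite cardsX -powersetT !card_powerset cardsT cardP -expnD leq_exp2l // leq_add2l.
by rewrite [#|~: I|]cardsCs setCK cardI leq_sub2r // -cardPF.
Qed.

Lemma exists_dense_red : exists s, forall A, red_free s A -> #|A| <= 2 * q ^ 2.
Proof.
suff /existsP[s /forallP h] :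
    [exists s, forall A, red_free s A ==> (#|A| <= 2 * q ^ 2)].
  by exists s => A; apply/implyP.
apply: contraT => /existsPn no.
have q1 : 1 < q := finNzRing_gt1 F.
have q13 : q <= q ^ 3 by rewrite -[X in X <= _]expn1 leq_exp2l.
have : \sum_(s : {set point * F}) 1 <= \sum_(s : {set point * F})
    \sum_(A : {set point}) (red_free s A && (2 * q ^ 2 < #|A|)).
  apply: leq_sum => s _; have /forallPn[A] := no s.
  by rewrite negb_imply -ltnNge (bigD1 A) //= => ->.
rewrite exchange_big sum1_card /= leqNgt => /negP[].
(* For large [A], [q * #|A| >= 2 q ^ 3 + q]. Over the [2 ^ (q ^ 3)] sets the total is then at most
   [2 ^ (q ^ 4 - q)], less than the number of choices of [s]. *)
have cA A : \sum_(s : {set point * F}) (red_free s A && (2 * q ^ 2 < #|A|))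
            <= 2 ^ (q ^ 4 - q ^ 3 - q).
  case: ltnP => bA; last by rewrite big1 // => s _; rewrite andbF.
  rewrite (eq_bigr (fun s => red_free s A : nat)); last by move=> s; rewrite andbT.
  have [cA qA] := card_red_free A.
  have -> : \sum_s (red_free s A : nat) = #|[set s | red_free s A]|.
    by rewrite -sum1_card [RHS]big_mkcond; apply: eq_bigr => s _; rewrite inE; case: ifP.
  apply: leq_trans cA _; rewrite leq_exp2l //.
  have : q * (2 * q ^ 2).+1 <= q * #|A| by rewrite leq_mul2l bA orbT.
  by rewrite mulnS mulnCA -expnS; lia.
apply: leq_ltn_trans (leq_sum _ (fun A _ => cA A)) _.
rewrite sum_nat_const.
have -> : #|{: {set point}}| = 2 ^ (q ^ 3).
  by rewrite -cardsT -powersetT card_powerset cardsT !card_prod !expnSr expn0 mul1n.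
have -> : #|{: {set point * F}}| = 2 ^ (q ^ 4).
  by rewrite -cardsT -powersetT card_powerset cardsT !card_prod !expnSr expn0 mul1n.
rewrite -expnD ltn_exp2l //.
have : 2 * q ^ 3 <= q ^ 4 by rewrite [q ^ 4]expnS leq_mul.
have : 0 < q by lia.
lia.
Qed.

(** * The coloring and its two-colored sets *)

Definition red_blue_color s x y : color :=
  if x.1 == y.1 then blue else if red_pair s x y then red else yellow.

Variables (n : nat) (f : 'I_n -> point).
Hypothesis f_inj : injective f.

(** Quantifying over both ends avoids ordering the edge; the diagonal pairs are harmless, since
    [red_pair] is irreflexive. *)
Definition design_coloring s : coloring n := [ffun e : edge n =>
  if [forall i in val e, forall j in val e, (f i).1 == (f j).1] then blue
  else if [exists i in val e, exists j in val e, red_pair s (f i) (f j)] then red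
  else yellow].

Lemma design_pair_color s i j : i != j ->
  pair_color (design_coloring s) i j = red_blue_color s (f i) (f j).
Proof.
move=> ij; have [e eE] := edge_of ij.
rewrite (pair_colorE _ eE) ffunE eE /red_blue_color.
have -> : [forall i' in [set i; j], forall j' in [set i; j],
    (f i').1 == (f j').1] = ((f i).1 == (f j).1).
  apply/forall_inP/idP => [h|/eqP h k].
    by have /forall_inP := h i (set21 _ _); apply; apply: set22.
  move=> kij; apply/forall_inP => l; move: kij; rewrite !inE.
  by move=> /orP[] /eqP-> /orP[] /eqP->; rewrite ?h.
case: ifP => // /eqP base; congr (if _ then _ else _).
have irr x : red_pair s x x = false.
  by apply/negbTE/negP => /red_pair_base.
apply/exists_inP/idP => [[k kij /exists_inP[l lij]]|h].
  by move: kij lij; rewrite !inE => /orP[] /eqP-> /orP[] /eqP->;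
    rewrite ?irr // red_pairC.
exists i; first exact: set21.
by apply/exists_inP; exists j; rewrite // set22.
Qed.

Lemma red_blue_colorC s x y : red_blue_color s x y = red_blue_color s y x.
Proof. by rewrite /red_blue_color eq_sym red_pairC. Qed.

(** This excludes all three patterns: blue is an equivalence, and two red edges are closed neither
    by blue ([red_pair_base_inj]) nor by red ([red_pair_triangle]). *)
Lemma path_color s x y z : x <> z ->
  match red_blue_color s x y, red_blue_color s y z with
  | red, red => red_blue_color s x z == yellow
  | blue, blue => red_blue_color s x z == blue
  | _, _ => true
  end.
Proof.
rewrite /red_blue_color => xz.
have [xy|xy] := eqVneq x.1 y.1; have [yz|yz] := eqVneq y.1 z.1.
- by rewrite xy yz eqxx.
- by case: ifP.
- by case: ifP.
case: ifP => [rxy|] //; case: ifP => [ryz|] //.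
case: (x.1 =P z.1) => [xz1|_]; first by case: xz; apply: red_pair_base_inj rxy ryz xz1.
by case: ifP => // rxz; case: (red_pair_triangle rxy ryz rxz).
Qed.

Lemma design_coloring_Forb s : design_coloring s \in Forb n three_patterns.
Proof.
apply/ForbP => i j k ij jk ik p; rewrite !design_pair_color //.
have ik' : f i <> f k by move=> /f_inj; apply/eqP.
have jk' : f j <> f k by move=> /f_inj; apply/eqP.
have ij' : f i <> f j by move=> /f_inj; apply/eqP.
have := path_color s (f j) ik'; have := path_color s (f k) ij'.
have := path_color s (f i) jk'; rewrite ![red_blue_color s (f k) _]red_blue_colorC.
rewrite [red_blue_color s (f j) (f i)]red_blue_colorC.
case: (red_blue_color s (f i) (f j)); case: (red_blue_color s (f j) (f k));
  case: (red_blue_color s (f i) (f k)) => //= _ _ _;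
  by rewrite !inE => /or3P[] /eqP->.
Qed.

Lemma h2_design : h2 n three_patterns <= 2 * q ^ 2.
Proof.
have [s hs] := exists_dense_red.
apply: leq_trans (h2_le (design_coloring_Forb s)) _.
have q1 : 1 < q := finNzRing_gt1 F.
have hS (S : {set 'I_n}) : (forall i j, i \in S -> j \in S -> i != j ->
    red_blue_color s (f i) (f j) != red) -> #|S| <= 2 * q ^ 2.
  move=> Sr; rewrite -(card_imset (mem S) f_inj); apply: hs.
  apply/indepP => _ _ /imsetP[i iS ->] /imsetP[j jS ->].
  apply/negP => rij; have := red_pair_base rij => bij.
  have ij : i != j by apply/eqP => ij; rewrite ij in bij.
  by have := Sr i j iS jS ij; rewrite /red_blue_color rij (introF eqP bij).
apply: h2c_le => S k Sk.
have Sk' i j : i \in S -> j \in S -> i != j -> red_blue_color s (f i) (f j) != k.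
  by move=> iS jS ij; rewrite -design_pair_color //; apply: Sk.
case: k Sk' {Sk} => [||] Sk; first exact: hS.
  (* Without blue, the points have distinct [(a, b)], so there are at most [q ^ 2]. *)
  have inj : {in S &, injective (fun i => (f i).1)}.
    move=> i j iS jS bij; apply/eqP; apply: contraT => ij.
    by have := Sk i j iS jS ij; rewrite /red_blue_color bij eqxx.
  rewrite -(card_in_imset inj); apply: leq_trans (max_card _) _.
  by rewrite card_prod mulnn leq_pmull.
(* Without yellow, a red edge [ij] admits no third vertex [k]: a second red edge would force a
   yellow one, and if [ik] and [jk] were blue so would be [ij]. *)
have [/existsP[i /existsP[j /and4P[iS jS ij /eqP rij]]]|no] :=
  boolP [exists i, exists j, [&& i \in S, j \in S, i != j &
    red_blue_color s (f i) (f j) == red]]; last first.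
  apply: hS => i j iS jS ij; move: no; rewrite negb_exists => /forallP/(_ i).
  by rewrite negb_exists => /forallP/(_ j); rewrite iS jS ij.
suff : S \subset [set i; j].
  by move=> /subset_leq_card; rewrite cards2 ij; nia.
apply/subsetP => k kS; rewrite !inE; apply: contraT; rewrite negb_or.
case/andP => ki kj.
have ij' : f i <> f j by move=> /f_inj; apply/eqP.
have ik' : f i <> f k by move=> /f_inj; apply/eqP; rewrite eq_sym.
have jk' : f j <> f k by move=> /f_inj; apply/eqP; rewrite eq_sym.
have := path_color s (f k) ij'; have := path_color s (f i) jk'.
have := path_color s (f j) ik'; have := Sk k i kS iS ki; have := Sk k j kS jS kj.
rewrite ![red_blue_color s (f k) _]red_blue_colorC.
rewrite [red_blue_color s (f j) (f i)]red_blue_colorC rij.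
by case: (red_blue_color s (f j) (f k)); case: (red_blue_color s (f i) (f k)).
Qed.

End Construction.

(** Take the field of order [q = 2 ^ k], so that [q ^ 3 = 8 ^ k] and [q ^ 2 = 4 ^ k]. *)
Lemma h2_upper_bound k n : 0 < k -> n <= 8 ^ k ->
  h2 n [:: rrr; rrb; bby] <= 2 * 4 ^ k.
Proof.
move=> k0 nk; have [F _ cF] := pPrimePowerField (isT : prime 2) k0.
have cP : n <= #|{: F * F * F}|.
  by rewrite !card_prod cF -!expnMn.
pose f (i : 'I_n) : F * F * F := enum_val (widen_ord cP i).
have f_inj : injective f by move=> i j /enum_val_inj/(congr1 val) /= ij; apply: val_inj.
by have := h2_design f_inj; rewrite cF -expnM (mulnC k) expnM.
Qed.

(** * Asymptotics *)

From mathcomp Require Import all_classical all_reals all_analysis.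
Import Order.TTheory GRing.Theory Num.Theory.
Import numFieldNormedType.Exports.
Local Open Scope classical_set_scope.
Local Open Scope ring_scope.

Lemma log2Xn (R : realType) m k : log2 (m%:R ^+ k) = k%:R * log2 m%:R :> R.
Proof.
rewrite /log2; case: m => [|m]; last by rewrite lnXn ?ltr0n // mulrA mulr_natl.
by case: k => [|k]; rewrite ?expr0 ?ln1 ?mul0r // expr0n /= ln0 // mul0r mulr0.
Qed.

Lemma log2_2 (R : realType) : log2 2 = 1 :> R.
Proof. by rewrite /log2 divff // gt_eqF // ln_gt0 // ltr1n. Qed.

Lemma ler_log2 (R : realType) (x y : R) : 0 < x -> x <= y -> log2 x <= log2 y.
Proof.
move=> x0 xy; rewrite /log2 ler_pM2r ?invr_gt0 ?ln_gt0 ?ltr1n //.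
by rewrite ler_ln // posrE // (lt_le_trans x0).
Qed.

Lemma log2_ge0 (R : realType) (x : R) : 1 <= x -> 0 <= log2 x.
Proof. by move=> x1; rewrite divr_ge0 ?ln_ge0 // ler1n. Qed.

(** From [n < 256 ^ L.+1] follows [log2 n <= 8 (L + 1) <= 16 L], hence
    [n log2 n <= 32 h ^ 2 <= (6 h) ^ 2]. The threshold on [n] ensures [L >= 2]. *)
Lemma sqrt_nlogn_le_h2 (R : realType) (n : nat) : (256 ^ 2 <= n)%N ->
  6^-1 * Num.sqrt (n%:R * log2 n%:R) <= (h2 n [:: rrr; rrb; bby])%:R :> R.
Proof.
move=> n2; set h := h2 _ _; pose L := trunc_log 256 n.
have n0 : (0 < n)%N by apply: leq_trans n2; rewrite expn_gt0.
have L1 : (1 < L)%N by apply: trunc_log_max.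
have := h2_lower_bound L1 (trunc_logP (isT : (1 < 256)%N) n0); rewrite -/h => nL.
have logn : log2 n%:R <= 16 * L%:R :> R.
  apply: (@le_trans _ _ (log2 (2%:R ^+ (8 * L.+1)))).
    apply: ler_log2; first by rewrite ltr0n.
    rewrite -natrX ler_nat expnM ltnW //; exact: trunc_log_ltn.
  rewrite log2Xn log2_2 mulr1 -natrM ler_nat.
  by rewrite -[16%N]/(8 * 2)%N -mulnA leq_mul2l /= mul2n -addnn -addn1 leq_add2l ltnW.
rewrite mulrC ler_pdivrMr // -[leRHS]ger0_norm ?mulr_ge0 // -sqrtr_sqr ler_sqrt.
  rewrite exprMn -[h%:R ^+ 2]natrX.
  have : n%:R * L%:R <= 2 * (h ^ 2)%:R :> R by rewrite -!natrM ler_nat.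
  have : n%:R * log2 n%:R <= n%:R * (16 * L%:R) :> R by rewrite ler_wpM2l.
  have : 0 <= (h ^ 2)%:R :> R by [].
  by rewrite [n%:R * (16 * _)]mulrCA; lra.
by rewrite sqr_ge0.
Qed.

(** As [8 ^ k.-1 < n <= 8 ^ k], the bound [2 * 4 ^ k = 8 * 4 ^ k.-1] is at most [8 n ^ (2 / 3)]; the
    logarithmic factor is at least 1 for [n >= 2]. *)
Lemma h2_le_powR (R : realType) (n : nat) : (1 < n)%N ->
  (h2 n [:: rrr; rrb; bby])%:R <=
    8 * (n%:R `^ (2 / 3) * Num.sqrt (log2 n%:R)) :> R.
Proof.
move=> n1; pose k := up_log 8 n.
have k0 : (0 < k)%N by rewrite up_log_gt0.
have := h2_upper_bound k0 (up_logP n (isT : (1 < 8)%N)) => hk.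
have kn : (8 ^ k.-1 < n)%N := up_log_gtn (isT : (1 < 8)%N) n1.
apply: (@le_trans _ _ (8 * n%:R `^ (2 / 3))); last first.
  rewrite ler_pM2l // ler_peMr ?powR_ge0 // -[leLHS]sqrtr1 ler_sqrt.
    by rewrite -[leLHS](@log2_2 R); apply: ler_log2; rewrite // ler_nat.
  by rewrite log2_ge0 // ler1n ltnW.
apply: (@le_trans _ _ (8 * (4 ^ k.-1)%:R)).
  rewrite -natrM ler_nat; apply: leq_trans hk _.
  by rewrite -(prednK k0) expnS mulnA.
rewrite ler_pM2l // (_ : (4 ^ k.-1)%:R = (8 ^ k.-1)%:R `^ (2 / 3)); last first.
  have -> : (8 ^ k.-1 = (2 ^ k.-1) ^ 3)%N by rewrite -expnM mulnC expnM.
  rewrite [in RHS]natrX -powR_mulrn // -powRrM mulrCA divff ?mulr1 ?pnatr_eq0 //.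
  by rewrite powR_mulrn // -natrX -expnM mulnC expnM.
by apply: ge0_ler_powR; rewrite ?nnegrE // ?divr_ge0 // ler_nat ltnW.
Qed.

Theorem lemma3p15 (R : realType) :
  ((fun n : nat => (h2 n [:: rrr; rrb; bby])%:R : R^o)
     =Omega_\oo (fun n : nat => Num.sqrt (n%:R * log2 n%:R) : R^o)) /\
  ((fun n : nat => (h2 n [:: rrr; rrb; bby])%:R : R^o)
     =O_\oo (fun n : nat => n%:R `^ (2 / 3) * Num.sqrt (log2 n%:R) : R^o)).
Proof.
split.
  rewrite eqOmegaE; apply/asboolP; exists 6^-1 => //.
  near=> n; rewrite !ger0_norm // ?sqrtr_ge0 //.
  by apply: sqrt_nlogn_le_h2; near: n; apply: nbhs_infty_ge.
apply/eqO_exP; exists 8 => //; near=> n.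
have n1 : (1 < n)%N by near: n; apply: nbhs_infty_ge.
rewrite !ger0_norm // ?mulr_ge0 ?powR_ge0 ?sqrtr_ge0 //.
exact: h2_le_powR.
Unshelve. all: by end_near.
Qed.
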